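(* Suppose that $\mathfrak g$ is a nonabelian nilpotent Lie algebra of dimension $n$. The following conditions are equivalent: (a) For each inner product on $\mathfrak g$, the only geodesics are the (nonzero) vectors orthogonal to the derived algebra $[\mathfrak g,\mathfrak g]$ and those contained in the centre $\mathfrak z(\mathfrak g)$ of $\mathfrak g$. (b) $\mathfrak g$ is $2$-step nilpotent and for each $X\in\mathfrak g$ with $X\notin\mathfrak z(\mathfrak g)$, the adjoint map $\operatorname{ad}(X)$ is surjective onto $[\mathfrak g,\mathfrak g]$.
   Context: All Lie algebras are finite-dimensional and over $\mathbb R$. Given an inner product $\langle\cdot,\cdot\rangle$ on a Lie algebra $\mathfrak g$ (arbitrary; no compatibility with the bracket is assumed), the Levi-Civita connection $\nabla$ is given by $2\langle\nabla_XY,Z\rangle=\langle[X,Y],Z\rangle+\langle[Z,X],Y\rangle+\langle[Z,Y],X\rangle$ for all $X,Y,Z\in\mathfrak g$. A subalgebra $\mathfrak h$ of $\mathfrak g$ is totally geodesic if $\nabla_YZ\in\mathfrak h$ for all $Y,Z\in\mathfrak h$. A nonzero element $Y\in\mathfrak g$ (not necessarily of unit length) is called a geodesic if the one-dimensional subalgebra $\operatorname{Span}(Y)$ is totally geodesic. Here $\operatorname{ad}(X)(Y)=[X,Y]$. *)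

(* Defs.v *)
From HB Require Import structures.
From mathcomp Require Import all_boot all_order all_algebra.
From mathcomp Require Import sesquilinear.
From mathcomp Require Import boolp classical_sets reals ring.

Set Implicit Arguments.
Unset Strict Implicit.
Unset Printing Implicit Defensive.

Import Order.TTheory GRing.Theory Num.Theory.

Local Open Scope ring_scope.

HB.mixin Record isLieAlgebra (F : fieldType) L & Vector F L := {
  lie : {bilinear L -> L -> L};
  liexx : forall x : L, lie x x = 0;
  lie_jacobi : forall x y z : L,
    lie x (lie y z) + lie y (lie z x) + lie z (lie x y) = 0
}.

#[short(type="lieAlgType")]
HB.structure Definition LieAlgebra (F : fieldType) :=
  { L of isLieAlgebra F L & Vector F L }.

Notation "[< x , y >]" := (lie x y)
  (at level 0, format "[< x ,  y >]") : ring_scope.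

Section LieAlgebraTheory.
Variables (F : fieldType) (g : lieAlgType F).
Implicit Types (x y z : g) (U V W : {vspace g}).

Definition lie_ad x : 'End(g) := linfun (lie x).

Lemma lie_adE x y : lie_ad x y = [<x, y>].
Proof. by rewrite lfunE. Qed.

Definition lie_abelian : Prop := forall x y, [<x, y>] = 0.

Definition lie_center : {vspace g} := lker (linfun lie_ad).

Fact lie_ad_linear : linear lie_ad.
Proof.
by move=> a x y; apply/lfunP => z; rewrite !lfunE /= !lfunE /= linearPl lie_adE.
Qed.

HB.instance Definition _ :=
  GRing.isLinear.Build F g 'End(g) *:%R lie_ad lie_ad_linear.

Lemma lie_centerP x : reflect (forall y, [<x, y>] = 0) (x \in lie_center).
Proof.
rewrite /lie_center memv_ker lfunE; apply: (iffP eqP) => [ad0 y | c0].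
  by rewrite -lie_adE ad0 lfunE.
by apply/lfunP => y; rewrite lie_adE c0 lfunE.
Qed.

(* Like prodv, the span is taken over brackets of basis vectors; lie_prodvP
   shows that this is the span of all brackets of elements of U and V. *)
Definition lie_prodv U V : {vspace g} :=
  <<[seq [<u, v>] | u <- vbasis U, v <- vbasis V]>>%VS.

Lemma memv_lie_prodv U V x y :
  x \in U -> y \in V -> [<x, y>] \in lie_prodv U V.
Proof.
move=> Ux Vy; rewrite (coord_vbasis Ux) (coord_vbasis Vy).
rewrite -applyrE linear_sum memv_suml // => i _; rewrite /= linear_sum.
rewrite memv_suml // => j _; rewrite linearZ_LR /= linearZl_LR /= !memvZ //.
rewrite memv_span //.
by apply/allpairsP; exists ((vbasis U)`_i, (vbasis V)`_j); rewrite !memt_nth.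
Qed.

Lemma lie_prodvP U V W :
  reflect {in U & V, forall x y, [<x, y>] \in W} (lie_prodv U V <= W)%VS.
Proof.
apply: (iffP idP) => [/subvP sW x y Ux Vy | sW].
  by apply: sW; exact: memv_lie_prodv.
apply/span_subvP => _ /allpairsP[[u v] /= [Uu Vv ->]].
by apply: sW; exact: vbasis_mem.
Qed.

Definition lie_derived : {vspace g} := lie_prodv fullv fullv.

Definition lower_central (k : nat) : {vspace g} :=
  iter k (lie_prodv fullv) fullv.

Definition lie_nilpotent : Prop := exists k, lower_central k = 0%VS.

(* Nilpotency class exactly k. *)
Definition step_nilpotent (k : nat) : Prop :=
  lower_central k = 0%VS /\ forall j, (j < k)%N -> lower_central j <> 0%VS.

Definition lie_subalgebra (U : {vspace g}) : Prop :=
  {in U &, forall x y, [<x, y>] \in U}.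

End LieAlgebraTheory.

Section LeviCivita.
Variables (R : realType) (g : lieAlgType R) (ip : {dot g for idfun}).
Implicit Types (x y z w : g) (h U : {vspace g}).

(* The equation determines w uniquely: see levi_civitaE and levi_civita_unique;
   the default value 0 of xget is never used. *)
Definition levi_civita x y : g :=
  xget 0 [set w | forall z,
    2 * ip w z = ip [<x, y>] z + ip [<z, x>] y + ip [<z, y>] x]%classic.

Lemma ip_inj w1 w2 : (forall z, ip w1 z = ip w2 z) -> w1 = w2.
Proof.
move=> eqw; apply/eqP; rewrite -subr_eq0; apply/negPn/negP => nz.
by have := neq0_dnorm_gt0 (s := ip) _ nz; rewrite linearBl /= eqw subrr ltxx.
Qed.

Definition ipo (w : g) : g -> R^o := ip w.

Fact ipo_linear w : linear (ipo w).
Proof. by move=> a u v; rewrite /ipo linearDr linearZr_LR. Qed.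

HB.instance Definition _ w :=
  GRing.isLinear.Build R g R^o *:%R (ipo w) (ipo_linear w).

Definition flat (w : g) : 'Hom(g, R^o) := linfun (ipo w).

Lemma flatE w z : flat w z = ip w z.
Proof. by rewrite lfunE. Qed.

Fact flat_linear : linear flat.
Proof.
move=> a u v; apply/lfunP => z.
by rewrite !lfunE /= lfunE /= !flatE /ipo linearPl.
Qed.

HB.instance Definition _ :=
  GRing.isLinear.Build R g 'Hom(g, R^o) *:%R flat flat_linear.

Lemma ip_riesz (f : {linear g -> R^o}) : exists w, forall z, ip w z = f z.
Proof.
have ker0 : lker (linfun flat) = 0%VS.
  apply/eqP/lker0P => u v; rewrite !lfunE /= => flat_uv; apply: ip_inj => z.
  by rewrite -!flatE flat_uv.
have full : limg (linfun flat) = fullv.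
  apply/eqP; rewrite eqEdim subvf /= limg_dim_eq ?ker0 ?capv0 //.
  by rewrite !dimvf /dim /= muln1.
have : linfun f \in limg (linfun flat) by rewrite full memvf.
case/memv_imgP => w _ /lfunP fw; exists w => z.
by have := fw z; rewrite !lfunE /= => ->; rewrite /ipo.
Qed.

Lemma levi_civitaE x y z :
  2 * ip (levi_civita x y) z = ip [<x, y>] z + ip [<z, x>] y + ip [<z, y>] x.
Proof.
rewrite /levi_civita; move: z; case: xgetP => // /(_ _) none.
pose k z := 2^-1 * (ip [<x, y>] z + ip [<z, x>] y + ip [<z, y>] x).
have k_lin : linear (k : g -> R^o).
  move=> a u v; change (k (a *: u + v) = a * k u + k v).
  rewrite /k !(linearPl, linearDr, linearZr_LR) /=; ring.
pose kL := HB.pack_for {linear g -> R^o} (k : g -> R^o)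
  (GRing.isLinear.Build R g R^o *:%R k k_lin).
have [w wE] := ip_riesz kL.
by case: (none w) => z; rewrite /= wE /= /k mulrA divff ?mul1r // pnatr_eq0.
Qed.

Lemma levi_civita_unique x y w :
  (forall z, 2 * ip w z = ip [<x, y>] z + ip [<z, x>] y + ip [<z, y>] x) ->
  w = levi_civita x y.
Proof.
move=> wE; apply: ip_inj => z.
by apply: (@mulfI _ 2); rewrite ?pnatr_eq0 // wE levi_civitaE.
Qed.

Definition totally_geodesic h : Prop :=
  lie_subalgebra h /\ {in h &, forall y z, levi_civita y z \in h}.

Definition geodesic y : Prop := y != 0 /\ totally_geodesic <[y]>%VS.

Definition orthogonal_to y U : Prop := {in U, forall z, ip y z = 0}.

End LeviCivita.

(* Main.v *)
Require Import Defs.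
From HB Require Import structures.
From mathcomp Require Import all_boot all_order all_algebra.
From mathcomp Require Import sesquilinear reals.
From mathcomp Require Import ring lra.

(** Evaluating the Koszul formula on a multiple of [Y] shows that a nonzero [Y]
    is a geodesic exactly when it is orthogonal to the image of [ad(Y)]
    ([geodesicE]): the component of [nabla_Y Y] along [Y] always vanishes, so
    being proportional to [Y] forces [nabla_Y Y = 0].

    Given (b), a noncentral geodesic is orthogonal to [im ad(Y)], which is the
    whole derived algebra; the other inclusion of (a) holds in every Lie
    algebra.

    Given (a), suppose that [X] is noncentral and that some [Z] in the derived
    algebra lies outside [V = im ad(X)].  Nilpotency gives that [X] is not in
    [V] either ([nilpotent_notin_limg_ad]), and for two vectors outside [V]
    there is an inner product in which [X] is orthogonal to [V] but not to [Z]
    ([separating_dot]).  In it [X] is a geodesic of neither of the two allowed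
    kinds, a contradiction.  So [ad(X)] maps onto the derived algebra for every
    noncentral [X].  If the derived algebra contained such an [X], then
    [g' = [X, g]] would be contained in [[g, g']] and the lower central series
    would be constant from [g'] on, against nilpotency since [g'] is nonzero; so
    the derived algebra is central and [g] is 2-step nilpotent. *)

Set Implicit Arguments.
Unset Strict Implicit.
Unset Printing Implicit Defensive.

Import Order.TTheory GRing.Theory Num.Theory.
Local Open Scope ring_scope.

(** * Inner products with a prescribed orthogonality *)

Lemma dotC (R : realType) (V : lmodType R) (ip : {dot V for idfun}) u v :
  ip u v = ip v u.
Proof. by rewrite (hermC ip) expr0 mul1r. Qed.

Lemma dot_of_form (R : realType) (V : lmodType R) (b : V -> V -> R) :
    (forall a u v w, b (a *: u + v) w = a * b u w + b v w) ->
    (forall u v, b u v = b v u) -> (forall u, u != 0 -> 0 < b u u) ->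
  exists ip : {dot V for idfun}, forall u v, ip u v = b u v.
Proof.
move=> b_lin bC b_gt0.
have b_bilin : bilinear_for (GRing.Scale.Law.clone _ _ *%R _)
    (GRing.Scale.Law.clone _ _ (idfun \; *%R) _) b.
  split=> [w a u v | w a u v] /=; first exact: b_lin.
  by rewrite bC b_lin !(bC _ w).
have bH u v : b u v = (-1) ^+ false * idfun (b v u) by rewrite expr0 mul1r bC.
pose m1 := bilinear_isBilinear.Build R V V R _ _ b b_bilin.
pose m2 := isHermitianSesquilinear.Build R V false idfun b bH.
pose m3 := isDotProduct.Build R V b b_gt0.
by exists (HB.pack_for {dot V for idfun} b m1 m2 m3).
Qed.

Lemma dot_exists (R : realType) (V : vectType R) :
  exists ip : {dot V for idfun}, True.
Proof.
have [||u u0|ip _] := @dot_of_form R V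
    (fun u v => \sum_i coord (vbasis fullv) i u * coord (vbasis fullv) i v);
  last by exists ip.
- move=> a u v w; rewrite mulr_sumr -big_split /=; apply: eq_bigr => i _.
  by rewrite linearP /= mulrDl mulrA.
- by move=> u v; apply: eq_bigr => i _; rewrite mulrC.
have sq_ge0 i : true ->
    0 <= coord (vbasis fullv) i u * coord (vbasis fullv) i u.
  by rewrite -expr2 sqr_ge0.
rewrite lt_neqAle sumr_ge0 // andbT eq_sym; apply: contra u0 => /eqP sum0.
rewrite (coord_vbasis (memvf u)) big1 // => i _.
have /eqP := psumr_eq0P sq_ge0 sum0 (i := i) isT.
by rewrite mulf_eq0 orbb => /eqP->; rewrite scale0r.
Qed.

(** Keep an arbitrary inner product on the kernel of [f], and declare [X] to be
    orthogonal to this kernel and of square norm [f X]. *)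
Lemma dot_with_form (R : realType) (V : vectType R) (f : V -> R) (X : V) :
    (forall a u v, f (a *: u + v) = a * f u + f v) -> 0 < f X ->
  exists ip : {dot V for idfun}, forall v, ip X v = f v.
Proof.
move=> f_lin fX_gt0; have fX_neq0 : f X != 0 by rewrite gt_eqF.
have [ip0 _] := dot_exists V.
(* The projection onto the kernel of [f] along [X]. *)
pose P u := u - (f u / f X) *: X.
have P_lin a u v : P (a *: u + v) = a *: P u + P v.
  rewrite /P f_lin scalerBr scalerA addrACA -opprD -scalerDl.
  by congr (_ - _ *: _); rewrite mulrDl mulrA.
have [||u u0|ip ipE] := @dot_of_form R V
    (fun u v => f u * f v / f X + ip0 (P u) (P v)).
- by move=> a u v w; rewrite P_lin f_lin linearPl /=; ring.
- by move=> u v; rewrite dotC (mulrC (f u)).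
- have [fu0|fu_neq0] := eqVneq (f u) 0.
    by rewrite /P fu0 !mul0r scale0r subr0 add0r neq0_dnorm_gt0.
  apply: ltr_pwDl; first by rewrite divr_gt0 // -expr2 exprn_even_gt0.
  have [->|?] := eqVneq (P u) 0; first by rewrite linear0l.
  exact/ltW/neq0_dnorm_gt0.
exists ip => v; rewrite ipE.
by rewrite [P X]/P divff // scale1r subrr linear0l addr0 mulrAC divff // mul1r.
Qed.

(** By [dot_with_form] it is enough to find one linear form that vanishes on
    [V], is positive at [X] and nonzero at [Z]. *)
Lemma separating_dot (R : realType) (E : vectType R) (V : {vspace E})
    (X Z : E) :
    X \notin V -> Z \notin V ->
  exists ip : {dot E for idfun}, {in V, forall v, ip X v = 0} /\ ip X Z != 0.
Proof.
move=> XnV ZnV; have [ip0 _] := dot_exists E.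
(* [Q] is linear with kernel [V], so the linear forms vanishing on [V] to be
   used are [ip0 a (Q _)]. *)
pose Q u := u - projv V u.
have Q_lin a u v : Q (a *: u + v) = a *: Q u + Q v.
  by rewrite /Q linearP /= scalerBr addrACA opprD.
have Q0 v : v \in V -> Q v = 0 by move=> Vv; rewrite /Q projv_id // subrr.
have Q_gt0 u : u \notin V -> 0 < ip0 (Q u) (Q u).
  move=> unV; apply: neq0_dnorm_gt0; apply: contra unV.
  by rewrite subr_eq0 => /eqP->; apply: memv_proj.
have [a [aX aZ]] : exists a, 0 < ip0 a (Q X) /\ ip0 a (Q Z) != 0.
  (* [a = Q X] is good for [X]; it fails for [Z] only if [Q X] and [Q Z] are
     orthogonal, and then their sum is good for both. *)
  have [XZ0|XZ] := eqVneq (ip0 (Q X) (Q Z)) 0; last first.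
    by exists (Q X); rewrite Q_gt0.
  exists (Q X + Q Z); split; last first.
    by rewrite linearDl /= XZ0 add0r gt_eqF ?Q_gt0.
  by rewrite linearDl /= (dotC _ (Q Z)) XZ0 addr0 Q_gt0.
have [|ip ipX] := @dot_with_form R E (fun u => ip0 a (Q u)) X _ aX.
  by move=> c u v; rewrite Q_lin linearPr.
by exists ip; split=> [v Vv|]; rewrite ipX // Q0 // linear0r.
Qed.

(** * Brackets and the lower central series *)

Section Lie.
Variables (F : fieldType) (g : lieAlgType F).
Implicit Types x y : g.

Lemma lieC x y : [<x, y>] = - [<y, x>].
Proof.
have := liexx (x + y); rewrite linearDl !linearDr /= !liexx add0r addr0.
by move/eqP; rewrite addr_eq0 => /eqP.
Qed.

Lemma limg_ad_derived x : (limg (lie_ad x) <= lie_derived g)%VS.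
Proof.
by apply/subvP=> _ /memv_imgP[y _ ->]; rewrite lie_adE memv_lie_prodv ?memvf.
Qed.

(** If [x = [x, y]], then [x] is an eigenvector of [ad(y)] for a nonzero
    eigenvalue, so it survives in every term of the lower central series. *)
Lemma nilpotent_notin_limg_ad x :
  lie_nilpotent g -> x != 0 -> x \notin limg (lie_ad x).
Proof.
case=> k gk0; apply: contra => /memv_imgP[y _]; rewrite lie_adE => xE.
suff: x \in lower_central g k by rewrite gk0 memv0.
elim: k {gk0} => [|k IHk]; first exact: memvf.
by rewrite xE lieC memvN; apply: memv_lie_prodv; rewrite ?memvf.
Qed.

Lemma derived0_abelian : lie_derived g = 0%VS -> lie_abelian g.
Proof.
by move=> d0 x y; apply/eqP; rewrite -memv0 -d0 memv_lie_prodv ?memvf.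
Qed.

Lemma stable_derived_eq0 : lie_nilpotent g ->
  (lie_derived g <= lie_prodv fullv (lie_derived g))%VS -> lie_derived g = 0%VS.
Proof.
case=> k gk0 d_sub; apply/eqP; rewrite -subv0 -gk0.
elim: k {gk0} => [|k IHk]; first exact: subvf.
apply: subv_trans d_sub _; apply/lie_prodvP=> x y _ dy.
by apply: memv_lie_prodv (memvf x) _; apply: (subvP IHk).
Qed.

Lemma central_derived_2step :
  ~ lie_abelian g -> (lie_derived g <= lie_center g)%VS -> step_nilpotent g 2.
Proof.
move=> nab d_central; split=> [|[|[|//]] _ lc0].
- apply/eqP; rewrite -subv0; apply/lie_prodvP=> x y _ dy.
  have /lie_centerP yC : y \in lie_center g by apply: (subvP d_central).
  by rewrite lieC yC oppr0 mem0v.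
- by apply/nab/derived0_abelian/eqP; rewrite -subv0 -lc0 subvf.
- exact/nab/derived0_abelian.
Qed.

(** A noncentral [x] in [g'] would give [g' = [x, g] <= [g, g']], against
    [stable_derived_eq0]. *)
Lemma surjective_ad_central_derived :
    ~ lie_abelian g -> lie_nilpotent g ->
    (forall x, x \notin lie_center g -> limg (lie_ad x) = lie_derived g) ->
  (lie_derived g <= lie_center g)%VS.
Proof.
move=> nab nil ad_surj; apply/subvP=> x dx; apply/negPn/negP => xnC.
apply/nab/derived0_abelian/stable_derived_eq0 => //.
rewrite -{1}(ad_surj x xnC).
apply/subvP=> _ /memv_imgP[y _ ->]; rewrite lie_adE lieC memvN.
by rewrite memv_lie_prodv ?memvf.
Qed.

End Lie.

(** * Geodesics *)

(** On the line of [Y] all brackets vanish, so the Koszul formula reduces to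
    [<nabla_Y Y, Z> = <[Z, Y], Y>]. *)
Lemma geodesicE (R : realType) (g : lieAlgType R) (ip : {dot g for idfun})
    (Y : g) :
  geodesic ip Y <-> Y != 0 /\ {in limg (lie_ad Y), forall v, ip Y v = 0}.
Proof.
split=> [[Y0 [_ tg]] | [Y0 orth]]; split=> //.
  have /vlineP[c cE] := tg Y Y (memv_line Y) (memv_line Y).
  (* Pairing with [Y] shows that the factor [c] is zero. *)
  have c0 : c = 0.
    have := levi_civitaE ip Y Y Y; rewrite cE !liexx linear0l !addr0.
    rewrite linearZl_LR /= => /eqP; rewrite !mulf_eq0 pnatr_eq0 /=.
    by rewrite (gt_eqF (neq0_dnorm_gt0 (s := ip) _ Y0)) orbF => /eqP.
  move=> _ /memv_imgP[z _ ->]; rewrite lie_adE lieC linearNr /= dotC.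
  have := levi_civitaE ip Y Y z; rewrite cE c0 scale0r liexx !linear0l mulr0.
  lra.
have orthZ z a b : ip [<z, a *: Y>] (b *: Y) = 0.
  rewrite !linearZr_LR /= linearZl_LR /= lieC linearNl /= dotC.
  by rewrite orth ?oppr0 ?mulr0 // -lie_adE memv_img ?memvf.
have lieZZ a b : [<a *: Y, b *: Y>] = 0.
  by rewrite linearZl_LR /= linearZr_LR /= liexx !scaler0.
split=> _ _ /vlineP[a ->] /vlineP[b ->]; first by rewrite lieZZ mem0v.
rewrite -(@levi_civita_unique _ _ ip _ _ 0) ?mem0v // => z.
by rewrite !orthZ lieZZ !linear0l mulr0 !addr0.
Qed.

Theorem proposition1p11 (R : realType) (n : nat) (g : lieAlgType R)
    (dim_g : \dim {:g} = n)
    (nonabelian_g : ~ lie_abelian g) (nilpotent_g : lie_nilpotent g) :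
  (forall (ip : {dot g for idfun}) (Y : g),
     geodesic ip Y <->
     Y != 0 /\ (orthogonal_to ip Y (lie_derived g) \/ Y \in lie_center g))
  <->
  (step_nilpotent g 2 /\
   forall X : g, X \notin lie_center g -> limg (lie_ad X) = lie_derived g).
Proof.
split=> [geo | [_ ad_surj] ip Y].
  have ad_surj X : X \notin lie_center g -> limg (lie_ad X) = lie_derived g.
    move=> XnC; apply/eqP; rewrite eqEsubv limg_ad_derived /=.
    apply/subvP=> Z dZ; apply/negPn/negP => ZnV.
    have X0 : X != 0 by apply: contraNneq XnC => ->; apply: mem0v.
    have XnV := nilpotent_notin_limg_ad nilpotent_g X0.
    have [ip [XV XZ]] := separating_dot XnV ZnV.
    have /geo[_ [Xd|]] : geodesic ip X by apply/geodesicE.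
      by rewrite Xd ?eqxx in XZ.
    by apply/negP.
  split=> //; apply: central_derived_2step => //.
  exact: surjective_ad_central_derived.
split=> [/geodesicE[Y0 orth] | [Y0 dor]].
  split=> //; case: (boolP (Y \in lie_center g)) => [|YnC]; [by right | left].
  by rewrite /orthogonal_to -(ad_surj Y YnC).
apply/geodesicE; split=> // v Vv; case: dor => [orth | /lie_centerP YC].
  exact/orth/(subvP (limg_ad_derived Y)).
by move: Vv => /memv_imgP[z _ ->]; rewrite lie_adE YC linear0r.
Qed.
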